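(* For every prime $p\geq3$, \[ 2^p=2+\sum_{k\geq0}(-1)^{k+1}p^{k+1}H_{p-1}(\overline{1},1^k), \] where $H_{p-1}(\overline1,1^k)=\sum_{p-1\geq n_1>n_2>\cdots>n_{k+1}\geq1}\frac{(-1)^{n_1}}{n_1n_2\cdots n_{k+1}}$.
   Context: Here $1^k$ denotes $k$ consecutive entries equal to $1$; the sum on the right is finite since $H_{p-1}(\overline1,1^k)=0$ when $k+1>p-1$. *)

(* Defs.v *)
From mathcomp Require Import all_boot all_order all_algebra.
From mathcomp Require Import classical_sets fsbigop.

Set Implicit Arguments.
Unset Strict Implicit.
Unset Printing Implicit Defensive.

Import GRing.Theory.
Local Open Scope ring_scope.

(* The alternating multiple harmonic sum H_N(\bar 1, 1^k): the index is the
   (k+1)-tuple (n_1, ..., n_(k+1)) with N >= n_1 > ... > n_(k+1) >= 1, encoded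
   with entries in 'I_N.+1 = {0, ..., N}; thead n is n_1. *)
Definition Hbar1 (N k : nat) : rat :=
  \sum_(n : k.+1.-tuple 'I_N.+1 |
          sorted gtn [seq val i | i <- n] && all (fun i : 'I_N.+1 => (0 < i)%N) n)
     (-1) ^+ (thead n : nat) / \prod_(j < k.+1) (tnth n j : nat)%:R.

(* Main.v *)
(* By the binomial theorem 2 ^ p - 2 is the sum of C(p, n) over 0 < n < p, and
   C(p, n) = (p / n) * C(p - 1, n - 1)
           = - (p / n) * (-1) ^ n * \prod_(0 < j < n) (1 - p / j).
   The coefficients of this product as a polynomial in p are, up to sign, the
   multiple harmonic sums H_(n-1)(1^k). *)
Require Import Defs.
From mathcomp Require Import all_boot all_order all_algebra.
From mathcomp Require Import classical_sets fsbigop.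
From mathcomp Require Import ring.

Set Implicit Arguments.
Unset Strict Implicit.
Unset Printing Implicit Defensive.

Import GRing.Theory Num.Theory.
Local Open Scope classical_set_scope.
Local Open Scope ring_scope.

Lemma big_tupleS (R : Type) (idx : R) (op : Monoid.com_law idx) (T : finType)
    (k : nat) (P : pred (k.+1.-tuple T)) (F : k.+1.-tuple T -> R) :
  \big[op/idx]_(t | P t) F t =
  \big[op/idx]_(x : T) \big[op/idx]_(t : k.-tuple T | P (cons_tuple x t))
    F (cons_tuple x t).
Proof.
rewrite pair_big_dep /= (reindex (fun u => cons_tuple u.1 u.2)) //=.
exists (fun t => (thead t, [tuple of behead t])) => [[x t] _|t _] /=.
  by congr (_, _); apply: val_inj.
by rewrite [in RHS](tuple_eta t); apply: val_inj.
Qed.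

Lemma sum_inner_bin (R : pzRingType) (m : nat) :
  \sum_(n < m) 'C(m.+1, n.+1)%:R = 2 ^+ m.+1 - 2 :> R.
Proof.
rewrite -[X in X ^+ _]/(1 + 1) exprD1n.
under [in RHS]eq_bigr do rewrite expr1n.
by rewrite big_ord_recl big_ord_recr /= bin0 binn addrCA addrK.
Qed.

Section NestedSum.
Variable R : comPzSemiRingType.
Implicit Types (f g : nat -> R) (a m k : nat).

Fixpoint nested_sum f a m k : R :=
  if k is k'.+1 then \sum_(a <= i < m) f i * nested_sum f a i k' else 1.

Lemma nested_sum_recr f a m k : (a <= m)%N ->
  nested_sum f a m.+1 k.+1 = nested_sum f a m k.+1 + f m * nested_sum f a m k.
Proof. exact: big_nat_recr. Qed.

Lemma nested_sum_eq0 f a m k : (m - a < k)%N -> nested_sum f a m k = 0.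
Proof.
elim: k m => [|k IHk] m //= mak; rewrite big_nat big1 // => i /andP[ai im].
rewrite IHk ?mulr0 // -ltnS (leq_trans _ mak) // ltnS.
by rewrite ltn_sub2r // (leq_ltn_trans ai).
Qed.

Lemma sum_nested_sum f a m K (q : R) : (m - a < K)%N ->
  \sum_(k < K) q ^+ k * nested_sum f a m k = \prod_(a <= i < m) (1 + q * f i).
Proof.
have empty_range n L : (n <= a)%N ->
    \sum_(k < L.+1) q ^+ k * nested_sum f a n k =
    \prod_(a <= i < n) (1 + q * f i).
  move=> na; rewrite big_geq // big_ord_recl big1 => [|k _].
    by rewrite mulr1 addr0.
  by rewrite /= big_geq // mulr0.
elim: m K => [|m IHm] [|K] // maK; first exact: empty_range.
have [am|ma] := leqP a m; last exact: empty_range.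
rewrite subSn // ltnS in maK.
transitivity (\sum_(k < K.+1) q ^+ k * nested_sum f a m k +
              q * f m * \sum_(k < K) q ^+ k * nested_sum f a m k).
  rewrite !big_ord_recl -addrA mulr_sumr; congr (_ + _).
  under eq_bigr => k _ do rewrite lift0 nested_sum_recr // mulrDr.
  rewrite big_split; congr (_ + _).
  by apply: eq_bigr => k _; rewrite exprS; ring.
by rewrite !IHm ?leqW // [RHS]big_nat_recr //=; ring.
Qed.

Definition descending M a m (s : seq 'I_M) : bool :=
  path gtn m [seq val i | i <- s] && all (fun i : 'I_M => (a <= i)%N) s.

Lemma sum_descending_cons M f g a m k : (m <= M)%N ->
  \sum_(t : k.+1.-tuple 'I_M | descending a m t)
    g (thead t) * \prod_(i <- behead t) f i =
  \sum_(a <= n < m)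
    g n * \sum_(t : k.-tuple 'I_M | descending a n t) \prod_(i <- t) f i.
Proof.
move=> mM; rewrite big_tupleS (big_nat_widen _ _ _ _ _ mM) big_geq_mkord.
rewrite [RHS]big_mkcond; apply: eq_bigr => n _.
case: ifPn => [/andP[/= nm an]|Nanm].
  rewrite mulr_sumr; apply: eq_big => [t|t _]; last by rewrite theadE.
  by rewrite /descending /= nm an.
apply: big_pred0 => t; apply: contraNF Nanm.
by case/andP => /= /andP[-> _] /andP[-> _].
Qed.

Lemma sum_descending M f a m k : (m <= M)%N ->
  \sum_(t : k.-tuple 'I_M | descending a m t) \prod_(i <- t) f i =
  nested_sum f a m k.
Proof.
elim: k m => [|k IHk] m mM.
  by rewrite (big_pred1 [tuple]) ?big_nil // => t; rewrite tuple0 /= eqxx.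
transitivity (\sum_(t : k.+1.-tuple 'I_M | descending a m t)
                f (thead t) * \prod_(i <- behead t) f i).
  by apply: eq_bigr => t _; rewrite {1}(tuple_eta t) big_cons.
rewrite (sum_descending_cons f f) //; apply: eq_big_nat => n /andP[_ nm].
by rewrite IHk // (leq_trans (ltnW nm)).
Qed.

End NestedSum.

Section HarmonicSum.
Variable F : numFieldType.
Implicit Types m n k : nat.

(* The multiple harmonic sum H_n(1^k); H_n(1) is the n-th harmonic number. *)
Definition harmonic_sum n k : F := nested_sum (fun j => j%:R^-1) 1 n.+1 k.

Lemma natr_bin_prod m n :
  'C(m, n)%:R = (-1) ^+ n * \prod_(1 <= j < n.+1) (1 - m.+1%:R / j%:R) :> F.
Proof.
elim: n => [|n IHn]; first by rewrite bin0 big_geq // mulr1.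
have n1_neq0 : n.+1%:R != 0 :> F by rewrite pnatr_eq0.
have natr_mul_bin_left :
    n.+1%:R * 'C(m, n.+1)%:R = (m%:R - n%:R) * 'C(m, n)%:R :> F.
  rewrite -natrM mul_bin_left natrM.
  by have [/natrB->|mn] := leqP n m; last by rewrite bin_small // !mulr0.
apply: (mulfI n1_neq0).
rewrite natr_mul_bin_left IHn exprS [in RHS]big_nat_recr //=.
by rewrite -!natr1 in n1_neq0 *; field.
Qed.

Lemma natr_bin_harmonic_sum m n K : (n < K)%N ->
  'C(m.+1, n.+1)%:R =
  \sum_(k < K) (- m.+1%:R) ^+ k.+1 *
    ((-1) ^+ n.+1 / n.+1%:R * harmonic_sum n k) :> F.
Proof.
move=> nK; have n1_neq0 : n.+1%:R != 0 :> F by rewrite pnatr_eq0.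
apply: (mulfI n1_neq0); rewrite -natrM -mul_bin_diag natrM natr_bin_prod.
under eq_bigr => j _ do rewrite -mulNr.
rewrite -(sum_nested_sum _ (K := K)) ?subn1 //.
rewrite !mulr_sumr; apply: eq_bigr => k _; rewrite /harmonic_sum !exprS.
by rewrite -!natr1 in n1_neq0 *; field.
Qed.

End HarmonicSum.

Lemma Hbar1E (N k : nat) :
  Hbar1 N k = \sum_(n < N) (-1) ^+ n.+1 / n.+1%:R * harmonic_sum rat n k.
Proof.
transitivity (\sum_(t : k.+1.-tuple 'I_N.+1 | descending 1 N.+1 t)
    (-1) ^+ thead t / (thead t)%:R * \prod_(i <- behead t) i%:R^-1 : rat).
  apply: eq_big => [t|t _].
    by rewrite (tuple_eta t) /descending /= ltn_ord.
  rewrite -(big_tuple _ _ t xpredT (fun i : 'I_N.+1 => i%:R : rat)).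
  by rewrite {2}(tuple_eta t) big_cons invfM mulrA prodfV.
rewrite (sum_descending_cons (fun j => j%:R^-1) (fun n => (-1) ^+ n / n%:R)) //.
rewrite big_add1 big_mkord; apply: eq_bigr => n _.
by rewrite (sum_descending (fun j => j%:R^-1)) // ltnW // ltnS.
Qed.

Lemma Hbar1_eq0 (N k : nat) : (N <= k)%N -> Hbar1 N k = 0.
Proof.
move=> Nk; rewrite Hbar1E big1 // => n _.
by rewrite /harmonic_sum nested_sum_eq0 ?mulr0 // subn1 (leq_trans (ltn_ord n)).
Qed.

Lemma sum_Hbar1 (m : nat) :
  \sum_(k < m) (- m.+1%:R) ^+ k.+1 * Hbar1 m k = 2 ^+ m.+1 - 2.
Proof.
under eq_bigr => k _ do rewrite Hbar1E mulr_sumr.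
rewrite exchange_big -sum_inner_bin; apply: eq_bigr => n _ /=.
by rewrite -natr_bin_harmonic_sum.
Qed.

Theorem theorem6 (p : nat) (p_prime : prime p) (p_ge3 : (3 <= p)%N) :
  2 ^+ p = 2 + \sum_(k \in [set: nat]) (-1) ^+ k.+1 * p%:R ^+ k.+1 * Hbar1 p.-1 k
    :> rat.
Proof.
rewrite -(@fsbig_widen _ _ _ _ `I_p.-1) //=; last first.
  by move=> k [_ /negP]; rewrite -leqNgt => pk /=; rewrite Hbar1_eq0 ?mulr0.
rewrite -fsbig_ord; case: p p_prime p_ge3 => // m _ _ /=.
under eq_bigr => k _ do rewrite -exprNn.
by rewrite sum_Hbar1 addrC subrK.
Qed.
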